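(* Let $A\in\mathbb{R}^{m\times n}$ and consider the first step of its CALU\_PRRP factorization with panel size $b<n$, threshold $\tau>1$ and a reduction tree of height $H$. Let $j$ be a row of $A$ that is not selected as a candidate row at a node $s_k$ at level $k$ of the tree, having taken part in the strong rank revealing QR factorization performed at $s_k$. Let $\bar A_k,\bar A_{k+1},\dots,\bar A_H$ be the $b\times b$ matrices formed by the candidate rows (restricted to the panel columns $1{:}b$) selected at the nodes of levels $k,k+1,\dots,H$ on the path from $s_k$ to the root, and assume they are all nonsingular. Let $\hat A_H$ be the $b\times(n-b)$ matrix formed by the columns $b+1{:}n$ of the pivot rows (the rows of $A$ selected at the root, in the same order as in $\bar A_H$), and let $$A^s(j,b+1{:}n)=A(j,b+1{:}n)-A(j,1{:}b)\,\bar A_H^{-1}\hat A_H$$ be the updated row $j$ after the first step of CALU\_PRRP. Define $$\hat A_{H-i}=-\bar A_{H-i}\bar A_{H-i+1}^{-1}\hat A_{H-i+1},\qquad 0<i\le H-k .$$ Then $A^s(j,b+1{:}n)$ is also obtained by performing LU\_PRRP on the matrix of size $((H-k+1)b+1)\times((H-k+1)b+n-b)$ $$A_{LU\_PRRP}=\begin{pmatrix} \bar A_H&&&&&\hat A_H\\ \bar A_{H-1}&\bar A_{H-1}&&&&\\ &\bar A_{H-2}&\bar A_{H-2}&&&\\ &&\ddots&\ddots&&\\ &&&\bar A_k&\bar A_k&\\ &&&&(-1)^{H-k}A(j,1{:}b)&A(j,b+1{:}n) \end{pmatrix};$$ that is, $A_{LU\_PRRP}$ equals the product $$\begin{pmatrix}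 I_b&&&&&\\ \bar A_{H-1}\bar A_H^{-1}&I_b&&&&\\ &\bar A_{H-2}\bar A_{H-1}^{-1}&I_b&&&\\ &&\ddots&\ddots&&\\ &&&\bar A_k\bar A_{k+1}^{-1}&I_b&\\ &&&&(-1)^{H-k}A(j,1{:}b)\bar A_k^{-1}&1 \end{pmatrix} \begin{pmatrix} \bar A_H&&&&&\hat A_H\\ &\bar A_{H-1}&&&&\hat A_{H-1}\\ &&\bar A_{H-2}&&&\hat A_{H-2}\\ &&&\ddots&&\vdots\\ &&&&\bar A_k&\hat A_k\\ &&&&&A^s(j,b+1{:}n) \end{pmatrix},$$ where all off-diagonal (multiplier) blocks of the first factor have entries at most $\tau$ in absolute value.
   Context: Blank blocks are zero; the arithmetic is exact. Strong rank revealing QR (strong RRQR) selection with threshold $\tau>1$: given a $p\times b$ matrix $B$, $p\ge b$, of full column rank, strong RRQR applied to $B^T$ yields a permutation $\Pi$ and $B^T\Pi=Q[R_{11}\;R_{12}]$ with $Q$ orthogonal, $R_{11}$ nonsingular upper triangular $b\times b$, and $\max_{i,j}|(R_{12}^T(R_{11}^{-1})^T)_{ij}|\le\tau$. It selects $b$ rows of $B$, forming a nonsingular $b\times b$ matrix $\bar B$, such that for every non-selected row $r$ of $B$ all entries of $r\bar B^{-1}$ have absolute value at most $\tau$. LU\_PRRP is the block LU factorization with panels of $b$ columns in which the $b$ pivot rows of each panel are chosen so that the multiplier block $\hat A_{21}\hat A_{11}^{-1}$ of the panel (with $\hat A_{11}$ the $b\times b$ block of pivot rows and $\hat A_{21}$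 the remaining rows of the panel) has entries bounded by $\tau$ in absolute value, the trailing matrix being then updated to the Schur complement $\hat A_{22}-\hat A_{21}\hat A_{11}^{-1}\hat A_{12}$. First step of CALU\_PRRP: the panel $A(:,1{:}b)$ is subjected to tournament pivoting with a reduction tree of height $H$ (levels from $0$ at the leaves to $H$ at the root). The rows of the panel are partitioned into blocks with at least $b$ rows, one block per leaf; at each leaf strong RRQR selects $b$ candidate rows from the block; at each internal node the candidate rows (always original rows of the panel) of its children are stacked and strong RRQR selects $b$ new candidate rows among them. The rows selected at the root are the $b$ pivot rows, moved to the top; every other row $j$ is then replaced, in columns $b+1{:}n$, by its Schur complement row $A^s(j,b+1{:}n)$. A row $j$ takes part in the factorization at a node of level $k\geq 1$ if it is a candidate row selected at level $k-1$ at one of the children of this node, and at a leaf ($k=0$) if it belongs to its block. *)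

(* Defs.v *)
From HB Require Import structures.
From mathcomp Require Import all_boot all_order all_algebra.
From mathcomp Require Import all_fingroup.

Set Implicit Arguments.
Unset Strict Implicit.
Unset Printing Implicit Defensive.

Import Order.TTheory GRing.Theory Num.Theory.
Local Open Scope ring_scope.

Definition bounded_by (R : rcfType) (tau : R) p q (M : 'M[R]_(p, q)) : Prop :=
  forall i l, `|M i l| <= tau.

Definition upper_triangular (R : rcfType) p (M : 'M[R]_p) : Prop :=
  forall i l : 'I_p, (l < i)%N -> M i l = 0.

(* B is (b + q) x b.  [col_perm s B^T] is B^T Pi: its l-th column is the
   (s l)-th row of B, so the selected rows are s 0, ..., s (b - 1). *)
Definition strong_RRQR (R : rcfType) (tau : R) b q
    (B : 'M[R]_(b + q, b)) (s : 'S_(b + q)) : Prop :=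
  exists (Q R11 : 'M[R]_b) (R12 : 'M[R]_(b, q)),
    [/\ Q *m Q^T = 1%:M,
        R11 \in unitmx /\ upper_triangular R11,
        col_perm s B^T = Q *m row_mx R11 R12
      & bounded_by tau (R12^T *m (invmx R11)^T)].

(* [c] lists the b rows of the panel P chosen among the rows in W: the rows of
   W are stacked in some order f, and strong RRQR supplies the permutation s.
   Strong RRQR is specified on matrices of full column rank only; on a rank
   deficient stack, c may be any b of the rows. *)
Definition RRQR_selection (R : rcfType) (tau : R) m b (P : 'M[R]_(m, b))
    (W : {set 'I_m}) (c : 'I_b -> 'I_m) : Prop :=
  exists (q : nat) (f : 'I_(b + q) -> 'I_m) (s : 'S_(b + q)),
    [/\ injective f,
        [set f i | i : 'I_(b + q)] = W,
        \rank (rowsub f P) = b -> strong_RRQR tau (rowsub f P) s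
      & forall i : 'I_b, c i = f (s (lshift q i))].

(* Finite rooted tree, of arbitrary arities, whose leaves all have level 0 and
   whose root has level H.  [parent tree_root] is irrelevant.  Since the
   tree is finite, the axioms force every level to be at most H. *)
Record reduction_tree (H : nat) := ReductionTree {
  node :> finType;
  level : node -> nat;
  tree_root : node;
  parent : node -> node;
  level_tree_root : level tree_root = H;
  level_parent : forall v, v != tree_root -> level (parent v) = (level v).+1;
  internal_child : forall v, (0 < level v)%N ->
    exists2 u, u != tree_root & parent u = v
}.

Definition children H (T : reduction_tree H) (v : T) : {set T} :=
  [set u | (u != tree_root T) && (parent u == v)].

(* [leaf_of r] is the leaf whose block contains row r; its fibres partition the
   rows.  [cand v] lists the candidate rows selected at v. *)
Definition participants m b H (T : reduction_tree H) (leaf_of : 'I_m -> T)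
    (cand : T -> 'I_b -> 'I_m) (v : T) : {set 'I_m} :=
  if level v == 0%N then [set r | leaf_of r == v]
  else \bigcup_(u in children v) [set cand u i | i : 'I_b].

Record tournament (R : rcfType) (tau : R) m b (P : 'M[R]_(m, b))
    H (T : reduction_tree H) (leaf_of : 'I_m -> T)
    (cand : T -> 'I_b -> 'I_m) : Prop := Tournament {
  leaf_of_leaf : forall r, level (leaf_of r) = 0%N;
  leaf_block_size : forall v : T, level v = 0%N ->
    (b <= #|[set r | leaf_of r == v]|)%N;
  cand_selection : forall v : T,
    RRQR_selection tau P (participants leaf_of cand v) (cand v)
}.

(* The node of level l on the path from v to the root (level v <= l <= H). *)
Definition ancestor H (T : reduction_tree H) (v : T) (l : nat) : T :=
  iter (l - level v) (@parent H T) v.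

Definition split_cols (R : rcfType) m n b (hbn : (b < n)%N) (A : 'M[R]_(m, n)) :
    'M[R]_(m, b + (n - b)) :=
  castmx (erefl m, esym (subnKC (ltnW hbn))) A.

(* The columns 1:b of A. *)
Definition panel (R : rcfType) m n b (hbn : (b < n)%N) (A : 'M[R]_(m, n)) :
    'M[R]_(m, b) := lsubmx (split_cols hbn A).

(* The columns b+1:n of A. *)
Definition trailing (R : rcfType) m n b (hbn : (b < n)%N) (A : 'M[R]_(m, n)) :
    'M[R]_(m, n - b) := rsubmx (split_cols hbn A).

(* [LU_panels tau b N M L U]: N panels of b columns of M are eliminated, the
   pivot rows of each panel being its first b rows; the part of M that remains
   after the N panels is left as it is in U, with an identity block in L.
   [LU_cast] only identifies propositionally equal sizes. *)
Inductive LU_panels (R : rcfType) (tau : R) (b : nat) :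
    nat -> forall p q, 'M[R]_(p, q) -> 'M[R]_p -> 'M[R]_(p, q) -> Prop :=
| LU_done p q (M : 'M[R]_(p, q)) : LU_panels tau b 0 M 1%:M M
| LU_panel N p q (A11 : 'M[R]_b) (A12 : 'M[R]_(b, q))
    (A21 : 'M[R]_(p, b)) (A22 : 'M[R]_(p, q)) (L : 'M[R]_p) (U : 'M[R]_(p, q)) :
    A11 \in unitmx ->
    bounded_by tau (A21 *m invmx A11) ->
    LU_panels tau b N (A22 - A21 *m invmx A11 *m A12) L U ->
    LU_panels tau b N.+1 (block_mx A11 A12 A21 A22)
      (block_mx 1%:M 0 (A21 *m invmx A11) L) (block_mx A11 A12 0 U)
| LU_cast N p q p' q' (epp : p = p') (eqq : q = q')
    (M : 'M[R]_(p, q)) (L : 'M[R]_p) (U : 'M[R]_(p, q)) :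
    LU_panels tau b N M L U ->
    LU_panels tau b N
      (castmx (epp, eqq) M) (castmx (epp, epp) L) (castmx (epp, eqq) U).

(* N panels of LU_PRRP on M with row permutation s, collecting the choices of
   pivot rows of all the panels. *)
Definition LU_PRRP (R : rcfType) (tau : R) (b N : nat) p q (M : 'M[R]_(p, q))
    (s : 'S_p) (L : 'M[R]_p) (U : 'M[R]_(p, q)) : Prop :=
  LU_panels tau b N (row_perm s M) L U.

(* In the three block matrices below d = H - k, so that the leading part has
   d + 1 block rows and columns of size b; block row i = 0, ..., d corresponds
   to the level H - i.  [Abar l] and [hatA l] are the matrices of level l. *)

Definition A_LU_PRRP (R : rcfType) b c (H k : nat) (Abar : nat -> 'M[R]_b)
    (hatA : nat -> 'M[R]_(b, c)) (aj : 'rV[R]_b) (tj : 'rV[R]_c) :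
    'M[R]_(\sum_(i < (H - k).+1) b + 1, \sum_(i < (H - k).+1) b + c) :=
  block_mx
    (\mxblock_(i < (H - k).+1, l < (H - k).+1)
       (if (l == i :> nat) || (l.+1 == i :> nat) then Abar (H - i)%N else 0))
    (\mxcol_(i < (H - k).+1) (if i == 0%N :> nat then hatA H else 0))
    (\mxrow_(l < (H - k).+1)
       (if l == (H - k)%N :> nat then (-1) ^+ (H - k) *: aj else 0))
    tj.

Definition L_factor (R : rcfType) b (H k : nat) (Abar : nat -> 'M[R]_b)
    (aj : 'rV[R]_b) : 'M[R]_(\sum_(i < (H - k).+1) b + 1) :=
  block_mx
    (\mxblock_(i < (H - k).+1, l < (H - k).+1)
       (if l == i :> nat then 1%:M
        else if l.+1 == i :> nat then Abar (H - i)%N *m invmx (Abar (H - l)%N)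
        else 0))
    0
    (\mxrow_(l < (H - k).+1)
       (if l == (H - k)%N :> nat then (-1) ^+ (H - k) *: (aj *m invmx (Abar k))
        else 0))
    1%:M.

Definition U_factor (R : rcfType) b c (H k : nat) (Abar : nat -> 'M[R]_b)
    (hatA : nat -> 'M[R]_(b, c)) (As : 'rV[R]_c) :
    'M[R]_(\sum_(i < (H - k).+1) b + 1, \sum_(i < (H - k).+1) b + c) :=
  block_mx
    (\mxblock_(i < (H - k).+1, l < (H - k).+1)
       (if l == i :> nat then Abar (H - i)%N else 0))
    (\mxcol_(i < (H - k).+1) hatA (H - i)%N)
    0
    As.

(* Main.v *)
Require Import Defs.
From HB Require Import structures.
From mathcomp Require Import all_boot all_order all_algebra.
From mathcomp Require Import all_fingroup.

Set Implicit Arguments.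
Unset Strict Implicit.
Unset Printing Implicit Defensive.

Import Order.TTheory GRing.Theory Num.Theory.
Local Open Scope ring_scope.

(** The multiplier bounds come from the tournament, the factorization from
elimination on a block bidiagonal matrix.

Strong RRQR at a node bounds by [tau] the entries of (row) * (selected block)^-1
for each row that was not selected; for a selected row this product is a row of
the identity, so the bound holds for every row taking part at the node, as soon
as the selected block is nonsingular ([RRQR_selection_multiplier]).  Applied to
row j at s_k it bounds the last multiplier.  Applied at the parent of a node to
the rows selected at that node, which all take part there
([participants_parent]), it bounds Abar_l * Abar_{l+1}^-1.

As long as there is more than one block row, eliminating the first block column
of [A_LU_PRRP] only changes the last block column: its block in the second block
row becomes - Abar_{H-1} Abar_H^-1 hatA_H = hatA_{H-1}.  The Schur complement is
therefore a matrix of the same shape with one block row and column fewer, and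
induction on the number of block rows gives the LU factors
([LU_panels_bidiag]).  The last row of U is
A(j,b+1:n) - (-1)^(H-k) A(j,1:b) Abar_k^-1 hatA_k.  The recurrence on hatA gives
Abar_{H-i}^-1 hatA_{H-i} = (-1)^i Abar_H^-1 hatA_H, so the two signs
cancel and this row is A^s(j,b+1:n). *)

(** * Multipliers of a strong RRQR selection *)

Section RRQR.
Variables (R : rcfType) (tau : R).

Lemma bounded_by0 p q : 0 <= tau -> bounded_by tau (0 : 'M[R]_(p, q)).
Proof. by move=> tau0 i l; rewrite mxE normr0. Qed.

(** In terms of the QR factors, the multiplier of the rows left out by strong
RRQR is R12^T R11^-T, since the orthogonal factor Q cancels. *)
Lemma strong_RRQR_multiplier b q (B : 'M[R]_(b + q, b)) (s : 'S_(b + q)) :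
  strong_RRQR tau B s ->
  bounded_by tau (rowsub (fun i => s (rshift b i)) B
                  *m invmx (rowsub (fun i => s (lshift q i)) B)).
Proof.
move=> [Q [R11 [R12 [QQ [R11u _] QR bnd]]]].
have Qu : Q \in unitmx by case/mulmx1_unit: QQ.
have selE : rowsub (fun i => s (lshift q i)) B = R11^T *m Q^T.
  rewrite -trmx_mul; apply/matrixP=> i l; move/matrixP/(_ l (lshift q i)): QR.
  by rewrite mul_mx_row row_mxEl !mxE.
have restE : rowsub (fun i => s (rshift b i)) B = R12^T *m Q^T.
  rewrite -trmx_mul; apply/matrixP=> i l; move/matrixP/(_ l (rshift b i)): QR.
  by rewrite mul_mx_row row_mxEr !mxE.
suff -> : rowsub (fun i => s (rshift b i)) B
          *m invmx (rowsub (fun i => s (lshift q i)) B)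
        = R12^T *m (invmx R11)^T by [].
have selu : R11^T *m Q^T \in unitmx by rewrite unitmx_mul !unitmx_tr R11u.
rewrite selE restE; apply: (canLR (mulmxK selu)).
by rewrite mulmxA -(mulmxA R12^T) -(trmx_mul R11) mulmxV // trmx1 mulmx1.
Qed.

(** The bound covers the selected rows too, and needs no rank assumption beyond
the nonsingularity of the selected block. *)
Lemma RRQR_selection_multiplier m b (P : 'M[R]_(m, b)) W c r :
  1 <= tau -> RRQR_selection tau P W c -> rowsub c P \in unitmx -> r \in W ->
  bounded_by tau (row r P *m invmx (rowsub c P)).
Proof.
move=> tau1 [q [f [s [_ <- strong cE]]]] cu /imsetP[x _ ->{r}].
have cPE : rowsub c P = rowsub (fun i => s (lshift q i)) (rowsub f P).
  by apply/matrixP=> i l; rewrite !mxE cE.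
have full : \rank (rowsub f P) = b.
  apply/eqP; rewrite eqn_leq rank_leq_col /= -{1}(mxrank_unit cu) cPE.
  exact/mxrankS/rowsub_sub.
have [y xE] : exists y, x = s y by exists (s^-1 x)%g; rewrite permKV.
case: (split_ordP y) => i yE i0 l; rewrite {x}xE {y}yE.
  (* A selected row: the product is a row of the identity matrix. *)
  rewrite -cE -row_rowsub -row_mul mulmxV // mxE mxE.
  by case: eqP; rewrite ?normr1 // normr0 (le_trans ler01).
have := strong_RRQR_multiplier (strong full) i l.
rewrite cPE; congr (`|_| <= _).
by rewrite !mxE; apply: eq_bigr => a _; rewrite !mxE.
Qed.
End RRQR.

(** * Levels along a path of the reduction tree *)

Section Tree.
Variables (H : nat) (T : reduction_tree H).

Lemma level_le (v : T) : (level v <= H)%N.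
Proof.
(* A node u of maximal level is the root: a parent has a larger level. *)
have [u _ umax] := @arg_maxnP T v xpredT (@level H T) isT.
apply: leq_trans (umax v isT) _.
have [->|/level_parent uE] := eqVneq u (tree_root T).
  by rewrite level_tree_root.
by have := umax (parent u) isT; rewrite uE /= ltnn.
Qed.

Lemma level_ancestor (v : T) l : (level v <= l <= H)%N ->
  level (ancestor v l) = l.
Proof.
rewrite /ancestor => /andP[vl]; rewrite -{1 3}(subnKC vl).
elim: (l - level v)%N => [|d IHd] lH; first by rewrite addn0.
rewrite addnS in lH *; have {}IHd := IHd (ltnW lH).
rewrite iterS level_parent ?IHd //; apply: contraTneq lH => rootE.
by rewrite -IHd rootE level_tree_root ltnn.
Qed.

Lemma ancestorS (v : T) l : (level v <= l)%N ->
  ancestor v l.+1 = parent (ancestor v l).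
Proof. by move=> vl; rewrite /ancestor subSn. Qed.

Lemma participants_parent m b leaf_of (cand : T -> 'I_b -> 'I_m) (v : T) i :
  v != tree_root T -> cand v i \in participants leaf_of cand (parent v).
Proof.
move=> vroot; rewrite /participants level_parent //=.
by apply/bigcupP; exists v; rewrite ?inE ?vroot ?eqxx // imset_f.
Qed.

End Tree.

(** * Block elimination on bordered block matrices *)

Section LU.
Variables (R : rcfType) (tau : R) (b : nat).

Lemma LU_panels_mul N p q (M : 'M[R]_(p, q)) L U :
  LU_panels tau b N M L U -> M = L *m U.
Proof.
elim=> {N p q M L U} [p q M|N p q A11 A12 A21 A22 L U A11u _ _ IH|].
- by rewrite mul1mx.
- rewrite mulmx_block !mul1mx !mul0mx !mulmx0 !addr0 -IH mulmxKV //.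
  by rewrite addrC subrK.
by move=> N p q p' q' epp eqq; case: _ / epp; case: _ / eqq.
Qed.

(** The block matrix with upper left part the N x N array of b x b blocks
[X i l], last block column [Y], last block row [z] and corner [t].  The blocks
are indexed by nat, so that removing the first block row and column is a shift
of the indices. *)
Definition bordered N r c (X : nat -> nat -> 'M[R]_b) (Y : nat -> 'M[R]_(b, c))
    (z : nat -> 'M[R]_(r, b)) (t : 'M[R]_(r, c)) :
    'M[R]_(\sum_(i < N) b + r, \sum_(i < N) b + c) :=
  block_mx (\mxblock_(i < N, l < N) X i l) (\mxcol_(i < N) Y i)
           (\mxrow_(l < N) z l) t.

Lemma eq_bordered N r c X X' (Y Y' : nat -> 'M[R]_(b, c))
    (z z' : nat -> 'M[R]_(r, b)) t t' :
  (forall i l, (i < N)%N -> (l < N)%N -> X i l = X' i l) ->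
  (forall i, (i < N)%N -> Y i = Y' i) ->
  (forall l, (l < N)%N -> z l = z' l) -> t = t' ->
  bordered N X Y z t = bordered N X' Y' z' t'.
Proof.
move=> eqX eqY eqz ->; congr block_mx.
- by apply: eq_mxblock => i l; apply: eqX.
- by apply: eq_mxcol => i; apply: eqY.
by apply: eq_mxrow => l; apply: eqz.
Qed.

Definition size_bordered N r : (b + (\sum_(i < N) b + r) =
  \sum_(i < N.+1) b + r)%N :=
  etrans (addnA _ _ _) (congr1 (addn^~ r) (@mxsize_recl N (fun=> b))).

(** A bordered matrix with its first block row and column split off, in the
shape on which a panel is eliminated. *)
Lemma bordered_recul N r c X (Y : nat -> 'M[R]_(b, c))
    (z : nat -> 'M[R]_(r, b)) t :
  bordered N.+1 X Y z t =
  castmx (size_bordered N r, size_bordered N c)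
    (block_mx (X 0 0)%N (row_mx (\mxrow_(l < N) X 0%N l.+1) (Y 0%N))
       (col_mx (\mxcol_(i < N) X i.+1 0%N) (z 0%N))
       (bordered N (fun i l => X i.+1 l.+1) (fun i => Y i.+1)
          (fun l => z l.+1) t)).
Proof.
rewrite /bordered block_mxA castmx_comp mxblock_recul mxcol_recu mxrow_recl.
have castb m1 m2 n1 n2 (e1 : m1 = m2) (e2 : n1 = n2) (U' : 'M[R]_(m1, n1))
     (V' : 'M_(m1, c)) (W' : 'M_(r, n1)) e3 :
   block_mx (castmx (e1, e2) U') (castmx (e1, erefl) V')
     (castmx (erefl, e2) W') t = castmx e3 (block_mx U' V' W' t).
  by case: _ / e1 e3; case: _ / e2 => e3; rewrite !castmx_id.
pose e p := congr1 (addn^~ p) (@mxsize_recl N (fun=> b)).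
by rewrite (castb _ _ _ _ _ _ _ _ _ (e r, e c)); apply: eq_castmx.
Qed.

Lemma bordered0_1 r : bordered 0 (fun _ _ => 0) (fun=> 0) (fun=> 0) 1%:M
  = 1%:M :> 'M[R]_(\sum_(i < 0) b + r).
Proof.
have n0 : \sum_(i < 0) b = 0%N by rewrite big_ord0.
rewrite (scalar_mx_block _ r) /bordered; congr block_mx; apply/matrixP=> i l.
- by have := ltn_ord i; rewrite {2}n0.
- by have := ltn_ord i; rewrite {2}n0.
by have := ltn_ord l; rewrite {2}n0.
Qed.

(** One panel of block elimination, block by block: [XL], [zL] carry the
multipliers and [XU], [YU], [tU] the reduced matrix; the last premise factors
the Schur complement of the block [X 0 0]. *)
Lemma LU_panels_bordered N r c X XL XU (Y YU : nat -> 'M[R]_(b, c))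
    (z zL : nat -> 'M[R]_(r, b)) t tU :
    X 0%N 0%N \in unitmx ->
    (forall i, (i < N)%N -> bounded_by tau (XL i.+1 0%N)) ->
    bounded_by tau (zL 0%N) ->
    XL 0%N 0%N = 1%:M -> (forall l, (l < N)%N -> XL 0%N l.+1 = 0) ->
    (forall i, (i < N)%N -> XL i.+1 0%N = X i.+1 0%N *m invmx (X 0%N 0%N)) ->
    zL 0%N = z 0%N *m invmx (X 0%N 0%N) ->
    XU 0%N 0%N = X 0%N 0%N ->
    (forall l, (l < N)%N -> XU 0%N l.+1 = X 0%N l.+1) ->
    (forall i, (i < N)%N -> XU i.+1 0%N = 0) -> YU 0%N = Y 0%N ->
    LU_panels tau b N
      (bordered N (fun i l => X i.+1 l.+1 - XL i.+1 0%N *m X 0%N l.+1)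
         (fun i => Y i.+1 - XL i.+1 0%N *m Y 0%N)
         (fun l => z l.+1 - zL 0%N *m X 0%N l.+1) (t - zL 0%N *m Y 0%N))
      (bordered N (fun i l => XL i.+1 l.+1) (fun=> 0) (fun l => zL l.+1) 1%:M)
      (bordered N (fun i l => XU i.+1 l.+1) (fun i => YU i.+1) (fun=> 0) tU) ->
  LU_panels tau b N.+1 (bordered N.+1 X Y z t)
    (bordered N.+1 XL (fun=> 0) zL 1%:M) (bordered N.+1 XU YU (fun=> 0) tU).
Proof.
move=> X0u bndX bndz XL00 XL0 XLE zLE XU00 XU0 XU0r YU0 stepLU.
rewrite !bordered_recul.
set A11 := X 0%N 0%N in X0u XLE zLE XU00 *.
set A12 := row_mx _ (Y 0%N); set A21 := col_mx _ (z 0%N).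
have multE : col_mx (\mxcol_(i < N) XL i.+1 0%N) (zL 0%N) = A21 *m invmx A11.
  rewrite mul_col_mx mxcol_mul zLE; congr col_mx.
  by apply: eq_mxcol => i; apply: XLE.
rewrite XL00 XU00 YU0 multE.
have -> : \mxrow_(l < N) XL 0%N l.+1 = 0.
  by rewrite -[RHS]mxrow0; apply: eq_mxrow => l; apply: XL0.
have -> : \mxrow_(l < N) XU 0%N l.+1 = \mxrow_(l < N) X 0%N l.+1.
  by apply: eq_mxrow => l; apply: XU0.
have -> : \mxcol_(i < N) XU i.+1 0%N = 0.
  by rewrite -[RHS]mxcol0; apply: eq_mxcol => i; apply: XU0r.
rewrite row_mx0 col_mx0; apply/LU_cast/LU_panel => //.
  rewrite -multE => i l; case: (split_ordP i) => a ->.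
    by rewrite col_mxEu mxE; apply: bndX.
  by rewrite col_mxEd; apply: bndz.
rewrite -multE mul_col_row mul_mxcol_mxrow mxcol_mul mul_mxrow.
rewrite /bordered opp_block_mx add_block_mx.
by rewrite -mxblockB -mxcolB -mxrowB.
Qed.

(** * LU factors of the bordered block bidiagonal matrix *)

Section Bidiagonal.
Variable c : nat.
Implicit Types (B : nat -> 'M[R]_b) (C : nat -> 'M[R]_(b, c)).

(** Block row i, for i = 0, ..., d, has [B i] on the diagonal and [B i] again
just left of it.  The border is a column with [C0] on top and a row with [w]
under the last diagonal block. *)
Definition bidiag_mx r d B (C0 : 'M[R]_(b, c)) (w : 'M[R]_(r, b)) t :=
  bordered d.+1 (fun i l => if (l == i) || (l.+1 == i) then B i else 0)
    (fun i => if i == 0%N then C0 else 0) (fun l => if l == d then w else 0) t.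

(** The unit lower triangular factor of [bidiag_mx d B C0 w t]. *)
Definition bidiag_L r d B (w : 'M[R]_(r, b)) :=
  bordered d.+1 (fun i l => if l == i then 1%:M
                            else if l.+1 == i then B i *m invmx (B l) else 0)
    (fun=> 0) (fun l => if l == d then w *m invmx (B d) else 0) 1%:M.

(** The upper triangular factor of [bidiag_mx d B (C 0) w t], when [C] satisfies
the recurrence of [LU_panels_bidiag] and [u] is the updated corner. *)
Definition bidiag_U r d B C (u : 'M[R]_(r, c)) :=
  bordered d.+1 (fun i l => if l == i then B i else 0) C (fun=> 0) u.

(** Each elimination step turns the top border block [C i] into [C i.+1] and
leaves the other blocks alone; the last step updates the corner. *)
Lemma LU_panels_bidiag r d B C (w : 'M[R]_(r, b)) t : 0 <= tau ->
  (forall i, (i <= d)%N -> B i \in unitmx) ->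
  (forall i, (i < d)%N -> bounded_by tau (B i.+1 *m invmx (B i))) ->
  bounded_by tau (w *m invmx (B d)) ->
  (forall i, (i < d)%N -> C i.+1 = - (B i.+1 *m invmx (B i) *m C i)) ->
  LU_panels tau b d.+1 (bidiag_mx d B (C 0%N) w t) (bidiag_L d B w)
    (bidiag_U d B C (t - w *m invmx (B d) *m C d)).
Proof.
move=> tau0; elim: d => [|d IHd] in B C *.
  move=> Bu _ bndw _; apply: LU_panels_bordered => //=; first exact: Bu.
  set M := bordered _ _ _ _ _; set L := bordered _ _ _ _ _.
  set U := bordered _ _ _ _ _.
  have -> : L = 1%:M by rewrite -bordered0_1; apply: eq_bordered.
  have -> : U = M by apply: eq_bordered.
  exact: LU_done.
move=> Bu bndB bndw CE; apply: LU_panels_bordered => //=.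
- exact: Bu.
- by case=> [|i] _; [apply: bndB | apply: bounded_by0].
- exact: bounded_by0.
- by case=> [|i]; rewrite ?mul0mx.
- by rewrite mul0mx.
set M := bordered _ _ _ _ _.
have -> : M = bidiag_mx d (fun i => B i.+1) (C 1%N) w t.
  apply: eq_bordered; rewrite ?mul0mx ?subr0 //.
  - by move=> i l _ _; rewrite mulmx0 subr0.
  - by case=> [|i] _ /=; rewrite sub0r ?CE // mul0mx oppr0.
  by move=> l _; rewrite subr0.
apply: (IHd (fun i => B i.+1) (fun i => C i.+1)) => // i id.
- exact: Bu.
- exact: bndB.
exact: CE.
Qed.

End Bidiagonal.
End LU.

(** * The factorization of the CALU_PRRP step *)

Theorem mainTheorem4 (R : rcfType) (m n b : nat) (hbn : (b < n)%N)
  (tau : R) (htau : 1 < tau) (A : 'M[R]_(m, n))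
  (H : nat) (T : reduction_tree H) (leaf_of : 'I_m -> T)
  (cand : T -> 'I_b -> 'I_m)
  (htour : tournament tau (panel hbn A) leaf_of cand)
  (k : nat) (sk : T) (hsk : level sk = k) (j : 'I_m)
  (hpart : j \in participants leaf_of cand sk)
  (hnsel : forall i : 'I_b, cand sk i != j)
  (Abar : nat -> 'M[R]_b)
  (hAbar : forall l, (k <= l <= H)%N ->
     Abar l = rowsub (cand (ancestor sk l)) (panel hbn A))
  (hunit : forall l, (k <= l <= H)%N -> Abar l \in unitmx)
  (hatA : nat -> 'M[R]_(b, n - b))
  (hhatH : hatA H = rowsub (cand (tree_root T)) (trailing hbn A))
  (hhat : forall i, (0 < i <= H - k)%N ->
     hatA (H - i)%N =
       - (Abar (H - i)%N *m invmx (Abar (H - i).+1) *m hatA (H - i).+1))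
  (As : 'rV[R]_(n - b))
  (hAs : As = row j (trailing hbn A)
              - row j (panel hbn A) *m invmx (Abar H) *m hatA H) :
  let aj := row j (panel hbn A) in
  let M := A_LU_PRRP H k Abar hatA aj (row j (trailing hbn A)) in
  let L := L_factor H k Abar aj in
  let U := U_factor H k Abar hatA As in
  [/\ LU_PRRP tau b (H - k).+1 M 1%g L U,
      M = L *m U,
      forall l, (k <= l < H)%N -> bounded_by tau (Abar l *m invmx (Abar l.+1))
    & bounded_by tau ((-1) ^+ (H - k) *: (aj *m invmx (Abar k)))].
Proof.
have tau1 := ltW htau; have tau0 := le_trans ler01 tau1.
have kH : (k <= H)%N by rewrite -hsk level_le.
pose v l := ancestor sk l.
have vlev l : (k <= l <= H)%N -> level (v l) = l.
  by move=> kl; rewrite level_ancestor ?hsk.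
have mult l r : (k <= l <= H)%N -> r \in participants leaf_of cand (v l) ->
    bounded_by tau (row r (panel hbn A) *m invmx (Abar l)).
  move=> kl rW; have := hunit _ kl; rewrite hAbar // => lu.
  exact: RRQR_selection_multiplier (cand_selection htour (v l)) lu rW.
have multB l : (k <= l < H)%N -> bounded_by tau (Abar l *m invmx (Abar l.+1)).
  case/andP=> kl lH i a; have kl' : (k <= l <= H)%N by rewrite kl ltnW.
  have vroot : v l != tree_root T.
    by apply: contraTneq lH => vE; rewrite -(vlev l) // vE level_tree_root ltnn.
  have := participants_parent leaf_of cand i vroot.
  rewrite -ancestorS ?hsk // => /mult-/(_ _ 0 a).
  rewrite leqW //= => /(_ lH); rewrite -row_rowsub -(hAbar l) //.
  by rewrite -row_mul mxE.
have multj : bounded_by tau (row j (panel hbn A) *m invmx (Abar k)).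
  by apply: mult; rewrite ?leqnn // /v /ancestor hsk subnn.
move=> aj M L U.
have multw : bounded_by tau ((-1) ^+ (H - k) *: (aj *m invmx (Abar k))).
  by move=> i l; rewrite mxE normrM normrX normrN1 expr1n mul1r.
(* Block row i carries the level H - i. *)
pose B i := Abar (H - i)%N; pose C i := hatA (H - i)%N; set d := (H - k)%N.
have lev i : (i <= d)%N -> (k <= H - i <= H)%N.
  by move=> id; rewrite leq_subr andbT -(subKn kH) leq_sub2l.
have Bd : B d = Abar k by rewrite /B subKn.
have Bu i : (i <= d)%N -> B i \in unitmx by move=> /lev; apply: hunit.
have HS i : (i < d)%N -> (H - i)%N = (H - i.+1).+1.
  by move=> id; rewrite -subSn ?subSS // (leq_trans id) ?leq_subr.
have CE i : (i < d)%N -> C i.+1 = - (B i.+1 *m invmx (B i) *m C i).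
  by move=> id; rewrite /C /B hhat // -HS.
have bndB i : (i < d)%N -> bounded_by tau (B i.+1 *m invmx (B i)).
  move=> id; rewrite /B (HS i) //; apply: multB.
  by case/andP: (lev i.+1 id) => -> _; rewrite -HS // leq_subr.
have solC i : (i <= d)%N ->
    invmx (B i) *m C i = (-1) ^+ i *: (invmx (B 0%N) *m C 0%N).
  elim: i => [|i IH] id; first by rewrite scale1r.
  rewrite CE // mulmxN -mulmxA mulKmx ?Bu // IH ?(ltnW id) //.
  by rewrite exprS mulN1r scaleNr.
have AsE : As = row j (trailing hbn A)
                - ((-1) ^+ d *: aj) *m invmx (B d) *m C d.
  rewrite hAs -mulmxA -[in RHS]mulmxA solC // -scalemxAl -scalemxAr scalerA.
  by rewrite -expr2 sqrr_sign scale1r /B /C subn0.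
have bndw : bounded_by tau ((-1) ^+ d *: aj *m invmx (B d)).
  by rewrite -scalemxAl Bd.
have LU : LU_panels tau b d.+1 M L U.
  have := LU_panels_bidiag (row j (trailing hbn A)) tau0 Bu bndB bndw CE.
  rewrite -AsE.
  have -> : bidiag_mx d B (C 0%N) ((-1) ^+ d *: aj) (row j (trailing hbn A))
            = M.
    by congr block_mx; apply: eq_mxcol => i; rewrite /C subn0.
  have -> : bidiag_L d B ((-1) ^+ d *: aj) = L.
    rewrite /bidiag_L /bordered mxcol0; congr block_mx; apply: eq_mxrow => l.
    by rewrite -scalemxAl Bd.
  have -> //: bidiag_U d B C As = U by rewrite /bidiag_U /bordered mxrow0.
split=> //; first by rewrite /LU_PRRP row_perm1.
exact: LU_panels_mul LU.
Qed.
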